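(* Let $\lambda$ be a partition of $N$ of length $p$. Choose uniformly at random a set partition $\pi$ of $\{1,\ldots,N\}$ of type $\lambda$, and then, uniformly at random, a permutation $\beta \in S_\pi$. Then the probability that $(1\ 2\ \ldots\ N)\beta^{-1}$ is an $N$-cycle is exactly $1/(N-p+1)$.
   Context: A set partition of $\{1,\ldots,N\}$ has type $\lambda$ if its block sizes, sorted, form the partition $\lambda$. For a set partition $\pi$, $S_\pi$ denotes the set of permutations $\beta$ of $\{1,\ldots,N\}$ each of whose cycles is contained in a single block of $\pi$. *)

(* Defs.v *)
From mathcomp Require Import all_boot all_order all_algebra all_fingroup.
Set Implicit Arguments. Unset Strict Implicit. Unset Printing Implicit Defensive.
Import GRing.Theory Num.Theory.

(* The ground set {1,...,N} is represented by 'I_N = {0,...,N-1}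
   (element k+1 of the paper is the ordinal k). *)

Definition is_int_partition (N : nat) (lam : seq nat) : bool :=
  [&& all (fun k => 0 < k) lam, sorted geq lam & sumn lam == N].

Definition setpart_type N (P : {set {set 'I_N}}) : seq nat :=
  sort geq (map (fun B : {set 'I_N} => #|B|) (enum P)).

Definition setparts_of_type N (lam : seq nat) : {set {set {set 'I_N}}} :=
  [set P | partition P [set: 'I_N] && (setpart_type P == lam)].

Definition S_pi N (P : {set {set 'I_N}}) : {set {perm 'I_N}} :=
  [set b : {perm 'I_N} | [forall C in porbits b, [exists B in P, C \subset B]]].

Definition long_cycle N : {perm 'I_N} := perm (@ordS_inj N).

Definition is_Ncycle N (s : {perm 'I_N}) : bool :=
  [exists x, porbit s x == [set: 'I_N]].

(* Probability that (1 2 ... N) beta^{-1} is an N-cycle when pi is uniform among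
   set partitions of type lam and then beta is uniform in S_pi.
   Note: in mathcomp, (s * t) x = t (s x), so (1 2 ... N) o beta^{-1}
   is written beta^-1 * long_cycle N. *)
Local Open Scope ring_scope.
Definition prob_Ncycle N (lam : seq nat) : rat :=
  \sum_(P in setparts_of_type N lam)
     (#|setparts_of_type N lam|%:R)^-1 *
     (#|[set b in S_pi P | is_Ncycle ((b^-1)%g * long_cycle N)%g]|%:R
        / #|S_pi P|%:R).

(* Main.v *)
Require Import Defs.
From mathcomp Require Import all_boot all_order all_algebra all_fingroup.
From mathcomp Require Import zify.
Import GRing.Theory Num.Theory.
Set Implicit Arguments. Unset Strict Implicit. Unset Printing Implicit Defensive.
Local Open Scope nat_scope.

(* Averaging over set partitions of a given type amounts to fixing one partition
   [P0], with Young subgroup [Y], and averaging over all conjugates [c ^ g] of the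
   long cycle [c]: how likely is it that [b * c ^ g] is a single cycle for a uniform
   [b] in [Y]? Take two blocks [A], [B] of [P0], put [U := A :|: B], and fix the
   factor of [b] outside [U]. Contracting the points outside [U] leaves a
   permutation [s] of [U], and the [b] in [Sym A x Sym B] for which [b * s] is a
   single cycle number [k (|A|-1)! (|B|-1)!], with [k] the number of points of [A]
   sent to [B] by [s]. Averaged over the conjugates of [s] by [Sym U], [k] is
   proportional to [|A| |B|], so the resulting probability depends on [U] and [s]
   only, not on how [U] is split into two nonempty blocks. Hence points may be moved
   freely between blocks until the type is [(N-p+1, 1, ..., 1)]; then [Y] is a
   symmetric group on [N-p+1] letters, and for every [g] exactly [(N-p)!] of its
   elements work. *)

(** * Cycle counts of permutations *)

Notation ncycles s := #|porbits s|.

(** In a product the left factor acts first, so the transposition cuts [x] out of its cycle: [x]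
    becomes a fixed point and its predecessor is sent to [s x]. *)
Lemma ncycles_split (T : finType) (s : {perm T}) x :
  s x != x -> ncycles (s * tperm x (s x))%g = (ncycles s).+1.
Proof.
move=> nfix.
(* [porbits_mul_tperm] wants the transposition on the left; conjugation moves it there. *)
have -> : (s * tperm x (s x))%g = (tperm ((s^-1)%g x) x * s)%g.
  by rewrite (conjgC (tperm _ _) s) tpermJ permKV.
have [|] := boolP (x \in porbit s ((s^-1)%g x)).
- move=> xin; have := porbits_mul_tperm s ((s^-1)%g x) x => /=.
  rewrite porbit_sym xin /= addn0 => ->; rewrite addnC.
  case: eqP => [E|_] //; case/eqP: nfix; by rewrite -{1}E permKV.
- by rewrite -{1}[x](permKV s) -{1}[s]expg1 mem_porbit.
Qed.

(** The points outside [D] are singleton cycles, and the cycle of [w] is one more. *)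
Lemma ncycles_lower_bound (T : finType) (s : {perm T}) (D : {set T}) (w : T) :
  w \in D -> perm_on D s -> #|T| < ncycles s + #|D|.
Proof.
move=> wD sD.
have sub : porbit s w |: [set porbit s x | x in ~: D] \subset porbits s.
  rewrite subUset sub1set imset_f //=; apply/subsetP=> _ /imsetP[x _ ->].
  exact: imset_f.
have porbD x : x \in ~: D -> porbit s x = [set x].
  rewrite inE => xD; apply/setP=> y; rewrite inE; apply/porbitP/eqP.
    case=> i ->; elim: i => [|i IH]; first by rewrite expg0 perm1.
    by rewrite expgSr permM IH (out_perm sD).
  by move=> ->; exists 0; rewrite expg0 perm1.
have := subset_leq_card sub; rewrite cardsU1 card_in_imset; last first.
  move=> x y xD yD; rewrite !porbD // => /setP/(_ x).
  by rewrite !inE eqxx => /esym/eqP.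
have -> : porbit s w \notin [set porbit s x | x in ~: D].
  apply/negP=> /imsetP[x xD E]; have := porbit_id s w.
  by rewrite E porbD // inE => /eqP wx; rewrite -wx inE wD in xD.
have := cardsC D; rewrite /=; lia.
Qed.

(** * Young subgroups with two blocks *)

(** For disjoint [A] and [B] this is [Sym A x Sym B]: stability of [B] follows from that of [A] and
    of the union. *)
Definition young2 (T : finType) (A B : {set T}) : {set {perm T}} :=
  [set b | perm_on (A :|: B) b && [forall x, (b x \in A) == (x \in A)]].

Lemma young2P (T : finType) (A B : {set T}) (b : {perm T}) :
  reflect (perm_on (A :|: B) b /\ forall x, (b x \in A) = (x \in A))
          (b \in young2 A B).
Proof.
rewrite inE; apply: (iffP andP) => -[bU bA]; split=> //.
  by move=> x; apply/eqP/(forallP bA).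
by apply/forallP=> x; apply/eqP.
Qed.

Lemma young2C (T : finType) (A B : {set T}) :
  [disjoint A & B] -> young2 A B = young2 B A.
Proof.
suff sub (X Y : {set T}) : [disjoint X & Y] -> young2 X Y \subset young2 Y X.
  by move=> d; apply/eqP; rewrite eqEsubset !sub // disjoint_sym.
move=> d; apply/subsetP=> b /young2P[bU bX]; apply/young2P.
rewrite setUC; split=> // x; have := perm_closed x bU; have := bX x.
have dd z : z \in Y -> z \notin X.
  by move=> zY; apply: contraL zY => zX; rewrite (disjointFr d).
rewrite !inE => E1.
case xY: (x \in Y); case bxY: (b x \in Y) => //; rewrite ?orbT ?orbF.
- by rewrite E1 (negbTE (dd _ xY)).
- by rewrite -E1 (negbTE (dd _ bxY)).
Qed.

Lemma young2_0r (T : finType) (A : {set T}) :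
  young2 A set0 = [set b | perm_on A b].
Proof.
apply/setP=> b; apply/young2P/idP; rewrite inE setU0; first by case.
by move=> bA; split=> // x; rewrite (perm_closed _ bA).
Qed.

(** Right multiplication by [tperm y z] carries the stabiliser of [y] onto the coset of elements
    that send [y] to [z]. *)
Lemma young2_remove (T : finType) (A B : {set T}) y z (b : {perm T}) :
  [disjoint A & B] -> y \in A -> z \in A ->
  ((b * tperm y z)%g \in young2 A B) && ((b * tperm y z)%g y == z)
  = (b \in young2 (A :\ y) B).
Proof.
move=> d yA zA; have yB : y \notin B by rewrite (disjointFr d).
have tA x : (tperm y z x \in A) = (x \in A).
  by case: tpermP => // ->; rewrite yA zA.
have tU : perm_on (A :|: B) (tperm y z).
  apply: subset_trans (tperm_on y z) _.
  by rewrite subUset !sub1set !inE yA zA.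
have -> : ((b * tperm y z)%g y == z) = (b y == y).
  by rewrite permM -(inj_eq (@perm_inj _ (tperm y z))) tpermK tpermR.
apply/andP/young2P.
- move=> [/young2P[bU bA] /eqP by_y]; split; last first.
    move=> x; have := bA x; rewrite permM tA !inE => ->.
    by rewrite -{1}by_y (inj_eq perm_inj).
  apply/subsetP=> x; rewrite inE => nbx.
  have xy : x != y by apply: contraNneq nbx => ->; rewrite by_y.
  have /subsetP/(_ x) : perm_on (A :|: B) b.
    rewrite -[b](mulgK (tperm y z)) tpermV; exact: perm_onM bU tU.
  by rewrite !inE xy => ->.
- move=> [bU bA].
  have by_y : b y = y by rewrite (out_perm bU) // !inE eqxx.
  split; last by rewrite by_y.
  apply/young2P; split.
    apply: perm_onM tU; apply: subset_trans bU _.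
    by apply: setSU; apply: subsetDl.
  move=> x; rewrite permM tA; have := bA x; rewrite !inE -{1}by_y (inj_eq perm_inj).
  by case: eqP => //= ->; rewrite by_y.
Qed.

Lemma card_young2_remove (T : finType) (A B : {set T}) y (Q : pred {perm T}) :
  [disjoint A & B] -> y \in A ->
  #|[set b in young2 A B | Q b]| =
  \sum_(z in A) #|[set b in young2 (A :\ y) B | Q (b * tperm y z)%g]|.
Proof.
move=> d yA; rewrite -sum1_card.
rewrite (partition_big (fun b : {perm T} => b y) (mem A)) /=; last first.
  by move=> b; rewrite inE => /andP[/young2P[_ bA] _]; rewrite bA.
apply: eq_bigr => z zA; rewrite -sum1_card.
rewrite (reindex_inj (mulIg (tperm y z))) /=; apply: eq_bigl => b.
rewrite !inE -andbA [Q _ && _]andbC andbA.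
by have := young2_remove b d yA zA; rewrite !inE => ->.
Qed.

Lemma card_young2 (T : finType) (A B : {set T}) :
  [disjoint A & B] -> #|young2 A B| = #|A|`! * #|B|`!.
Proof.
have [n] := ubnP #|A|; elim: n A => // n IH A ltAn d.
have [->|[y yA]] := set_0Vmem A.
  have d0 : [disjoint set0 & B] by rewrite -setI_eq0 set0I.
  by rewrite young2C // young2_0r cardsE card_perm cards0 fact0 mul1n.
have dy : [disjoint A :\ y & B] by apply: disjointWl d; apply: subsetDl.
have Ay : #|A| = #|A :\ y|.+1 by rewrite (cardsD1 y) yA.
have -> : #|young2 A B| = #|[set b in young2 A B | true]|.
  by apply: eq_card => b; rewrite [RHS]inE andbT.
rewrite (card_young2_remove predT d yA).
rewrite (eq_bigr (fun _ => #|A :\ y|`! * #|B|`!)).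
  by rewrite sum_nat_const Ay factS mulnA.
have ltA'n : #|A :\ y| < n by rewrite -ltnS -Ay.
move=> z _; rewrite -(IH _ ltA'n dy).
by apply: eq_card => b; rewrite [LHS]inE andbT.
Qed.

(** * Products that are a single cycle on one or two blocks *)

(* A permutation of [A :|: B], extended by the identity to [T], is a single
   cycle on a nonempty [A :|: B] iff it has [#|T| - #|A :|: B| + 1] cycles. *)
Definition full_cycles (T : finType) (A B : {set T}) (s : {perm T}) : {set {perm T}} :=
  [set b in young2 A B | ncycles (b * s)%g + #|A :|: B| == #|T|.+1].

Lemma full_cyclesC (T : finType) (A B : {set T}) (s : {perm T}) :
  [disjoint A & B] -> full_cycles A B s = full_cycles B A s.
Proof. by move=> d; rewrite /full_cycles young2C // setUC. Qed.

Lemma perm_onD1 (T : finType) (U : {set T}) (s : {perm T}) y :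
  perm_on U s -> s y = y -> perm_on (U :\ y) s.
Proof.
move=> sU sy; apply/subsetP=> x; rewrite inE => nx; rewrite !inE.
rewrite (subsetP sU) ?inE // andbT; apply: contraNneq nx => ->; by rewrite sy.
Qed.

Lemma perm_on_tperm (T : finType) (U : {set T}) y z :
  y \in U -> z \in U -> perm_on U (tperm y z).
Proof.
by move=> yU zU; apply: subset_trans (tperm_on y z) _; rewrite subUset !sub1set yU.
Qed.

Lemma perm_on_contract (T : finType) (U : {set T}) (s : {perm T}) y z :
  perm_on U s -> y \in U -> z \in U ->
  perm_on (U :\ y) (tperm y z * s * tperm y (s z))%g.
Proof.
move=> sU yU zU; apply: perm_onD1; last by rewrite !permM tpermL tpermR.
by rewrite !perm_onM ?perm_on_tperm // (perm_closed _ sU).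
Qed.

(** Write [b] as [b' * tperm y z] with [z = b y] and [b'] fixing [y]. Then [b * s] sends [y] to
    [s z], and [tperm y (s z)] cuts [y] out of its cycle. This gives one cycle more on a union with
    one point less, so the condition on the number of cycles persists. *)
Lemma card_full_cycles_rec (T : finType) (A B : {set T}) (s : {perm T}) y :
  [disjoint A & B] -> y \in A -> 1 < #|A :|: B| -> perm_on (A :|: B) s ->
  #|full_cycles A B s| =
  \sum_(z in A | s z != y)
    #|full_cycles (A :\ y) B (tperm y z * s * tperm y (s z))%g|.
Proof.
move=> d yA U1 sU; rewrite /full_cycles.
rewrite (card_young2_remove (fun b => ncycles (b * s)%g + #|A :|: B| == #|T|.+1) d yA).
have yU : y \in A :|: B by rewrite inE yA.
have yB : y \notin B by rewrite (disjointFr d).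
have UE : (A :\ y) :|: B = (A :|: B) :\ y.
  by apply/setP=> x; rewrite !inE; case: eqP => // ->; rewrite (negbTE yB).
have cU : #|A :|: B| = #|(A :|: B) :\ y|.+1 by rewrite (cardsD1 y (A :|: B)) yU.
(* If [s z = y], the product fixes [y], so it is supported on the nonempty rest of the union and has
   at least one cycle too many. *)
rewrite (bigID (fun z => s z != y)) /= [X in _ + X]big1 ?addn0; last first.
  move=> z /andP[zA]; rewrite negbK => /eqP sz; apply/eqP.
  rewrite cards_eq0; apply/eqP/setP=> b; rewrite inE in_set0.
  apply/andP=> -[/young2P[]]; rewrite UE => bU _ /eqP E.
  have zU : z \in A :|: B by rewrite inE zA.
  have dU : perm_on ((A :|: B) :\ y) (b * tperm y z * s)%g.
    apply: perm_onD1.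
      rewrite !perm_onM ?perm_on_tperm //.
      by apply: subset_trans bU _; apply: subsetDl.
    by rewrite !permM (out_perm bU) ?tpermL // !inE eqxx.
  have [w wU] : exists w, w \in (A :|: B) :\ y.
    by apply/set0Pn; rewrite -card_gt0; lia.
  by have := ncycles_lower_bound wU dU; rewrite -ltnS -E cU addnS ltnn.
apply: eq_bigr => z /andP[zA nsz]; apply: eq_card => b; rewrite !inE.
case bY: (perm_on _ b && _) => //=.
have /young2P[] : b \in young2 (A :\ y) B by rewrite inE.
rewrite UE => bU _.
have by_y : b y = y by rewrite (out_perm bU) // !inE eqxx.
have dy : (b * tperm y z * s)%g y = s z by rewrite !permM by_y tpermL.
have := @ncycles_split _ (b * tperm y z * s)%g y; rewrite dy => /(_ nsz).
by rewrite !mulgA cU => ->; rewrite addSnnS.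
Qed.

(** In the recursion only the choice [z = s^-1 y] is excluded, whatever [s] is, so the factorial
    builds up by induction. *)
Lemma card_full_cycles1 (T : finType) (A : {set T}) (s : {perm T}) a :
  #|A| = a.+1 -> perm_on A s -> #|full_cycles A set0 s| = a`!.
Proof.
have d0 (C : {set T}) : [disjoint C & set0] by rewrite -setI_eq0 setI0.
elim: a A s => [|a IH] A s cA sA.
  have /eqP/cards1P[y Ay] := cA.
  have on1 (b : {perm T}) : perm_on A b -> b = 1%g.
    by move=> bA; apply: (perm_on_id bA); rewrite cA.
  have -> : full_cycles A set0 s = [set 1%g].
    apply/setP=> b; rewrite /full_cycles young2_0r !inE setU0 cA.
    rewrite (on1 _ sA) mulg1.
    apply/andP/eqP=> [[bA _]|->]; first exact: on1.
    split; first exact: perm_on1.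
    have yA : y \in A by rewrite Ay inE.
    have := ncycles_lower_bound yA (perm_on1 A).
    rewrite cA !addn1 ltnS => lb.
    by rewrite eqSS eqn_leq lb andbT; apply: leq_imset_card.
  by rewrite cards1.
have [y yA] : exists y, y \in A by apply/set0Pn; rewrite -card_gt0 cA.
have cAy : #|A :\ y| = a.+1 by move: cA; rewrite (cardsD1 y) yA => -[].
rewrite (card_full_cycles_rec (y := y)) ?setU0 ?cA //.
rewrite (eq_bigr (fun _ => a`!)); last first.
  by move=> z /andP[zA _]; apply: IH => //; apply: perm_on_contract.
rewrite sum_nat_const factS; congr (_ * _).
pose y' := (s^-1)%g y.
have y'A : y' \in A by rewrite -(perm_closed _ sA) permKV.
have -> : #|[pred z in A | s z != y]| = #|A :\ y'|.
  apply: eq_card => z; rewrite !inE andbC; congr (_ && _).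
  by rewrite -{1}[y](permKV s) (inj_eq perm_inj).
by move: cA; rewrite (cardsD1 y') y'A => -[].
Qed.

Definition crossing (T : finType) (A B : {set T}) (s : {perm T}) : {set T} :=
  [set x in A | s x \in B].

(** Up to relabelling by [tperm y z], the contraction drops [z] from the domain and redirects
    [s^-1 y] to [s z]. If [s z] is in [B], the crossing at [z] is lost, and it reappears at [s^-1 y]
    exactly when that point is in [A]. *)
Lemma card_crossing_contract (T : finType) (A B : {set T}) (s : {perm T}) y z :
  [disjoint A & B] -> perm_on (A :|: B) s -> y \in A -> z \in A -> s z != y ->
  #|crossing (A :\ y) B (tperm y z * s * tperm y (s z))%g|
    + (((s^-1)%g y \in B) && (s z \in B)) = #|crossing A B s|.
Proof.
move=> d sU yA zA nsz; set s' := (_ * _)%g.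
have yB : y \notin B by rewrite (disjointFr d).
set y' := (s^-1)%g y; have sy' : s y' = y by rewrite permKV.
have y'z : y' != z by apply: contraNneq nsz => <-; rewrite sy'.
have y'U : (y' \in A) || (y' \in B).
  by have := perm_closed y' sU; rewrite sy' !inE yA => /esym.
have -> : #|crossing (A :\ y) B s'|
        = #|[set x in A :\ z | (s x \in B) || (x == y') && (s z \in B)]|.
  rewrite -(card_imset _ (@perm_inj _ (tperm y z))); apply: eq_card => x.
  have -> : x = tperm y z (tperm y z x) by rewrite tpermK.
  move: (tperm y z x) => {}x; rewrite mem_imset; last exact: perm_inj.
  rewrite !inE; have tA : (tperm y z x \in A) = (x \in A).
    by case: tpermP => // ->; rewrite yA zA.
  have -> : (tperm y z x == z) = (x == y).
    by rewrite -{2}(tpermL y z) (inj_eq perm_inj).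
  rewrite tA; case: eqP => //= /eqP xy; congr (_ && _).
  have E : s' x = tperm y (s z) (s (tperm y z x)) by rewrite !permM.
  rewrite E; have sx : s (tperm y z x) != s z.
    by rewrite (inj_eq perm_inj) -{2}(tpermL y z) (inj_eq perm_inj).
  have -> : (tperm y z x == y') = (s (tperm y z x) == y).
    by rewrite -[X in _ = (_ == X)]sy' (inj_eq perm_inj).
  move: (s (tperm y z x)) sx => w; case: tpermP => [->|->|/eqP/negbTE->] //.
  - by rewrite eqxx (negbTE yB).
  - by rewrite eqxx.
  - by rewrite orbF.
have [szB|szB] := boolP (s z \in B); last first.
  rewrite andbF addn0; apply: eq_card => x; rewrite !inE andbF orbF.
  by case: (x =P z) => //= ->; rewrite (negbTE szB) andbF.
have zC : z \in crossing A B s by rewrite inE zA.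
rewrite andbT (cardsD1 z (crossing A B s)) zC addnC.
have [y'B|y'B] := boolP (y' \in B).
  congr (_ + _); apply: eq_card => x; rewrite !inE andbT.
  case: (x =P y') => [->|]; last by rewrite orbF andbA.
  by rewrite sy' (negbTE yB) andbF (disjointFl d y'B) !andbF.
have y'A : y' \in A by rewrite (negbTE y'B) orbF in y'U.
rewrite [RHS]addnC addn1 add0n.
have -> : [set x in A :\ z | (s x \in B) || (x == y') && true]
        = y' |: (crossing A B s :\ z).
  apply/setP=> x; rewrite !inE andbT; case: (x =P y') => [->|]; last by rewrite orbF andbA.
  by rewrite y'z y'A orbT.
by rewrite cardsU1 !inE sy' (negbTE yB) !andbF.
Qed.

(** In the inductive step the crossing numbers left after contraction, summed over the allowed [z],
    give [#|A| - 1] times the crossing number of [s]. *)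
Lemma card_full_cycles2 (T : finType) (A B : {set T}) (s : {perm T}) a b :
  [disjoint A & B] -> #|A| = a.+1 -> #|B| = b.+1 -> perm_on (A :|: B) s ->
  #|full_cycles A B s| = #|crossing A B s| * (a`! * b`!).
Proof.
elim: a A s => [|a IH] A s d cA cB sU.
  have /eqP/cards1P[y Ay] := cA.
  have yA : y \in A by rewrite Ay inE.
  have yB : y \notin B by rewrite (disjointFr d).
  have AyE : A :\ y = set0 by rewrite Ay setDv.
  have UE : (A :|: B) :\ y = B.
    by rewrite setDUl AyE set0U; apply/setDidPl; rewrite disjoint_sym disjoints1.
  have cU : 1 < #|A :|: B| by rewrite (cardsD1 y) inE yA UE cB.
  rewrite (card_full_cycles_rec d yA cU sU) AyE.
  have d0 : [disjoint set0 & B] by rewrite -setI_eq0 set0I.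
  (* For [A = [set y]] the crossing number is 1 or 0 according to whether [s] moves [y]. *)
  have szB : (s y \in B) = (s y != y).
    have := perm_closed y sU; rewrite !inE yA Ay inE /=.
    by case: eqP => [-> _|//]; rewrite (negbTE yB).
  rewrite (eq_bigr (fun _ => b`!)).
    rewrite sum_nat_const fact0 mul1n; congr (_ * _).
    apply: eq_card => z; rewrite [LHS]unfold_in /= !inE Ay inE.
    by case: (z =P y) => [->|//]; rewrite szB.
  move=> z /andP[zA _]; rewrite full_cyclesC //; apply: card_full_cycles1 => //.
  by rewrite -{1}UE; apply: perm_on_contract => //; rewrite inE ?yA ?zA.
have [y yA] : exists y, y \in A by apply/set0Pn; rewrite -card_gt0 cA.
have cAy : #|A :\ y| = a.+1 by move: cA; rewrite (cardsD1 y) yA => -[].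
have yB : y \notin B by rewrite (disjointFr d).
have UE : (A :\ y) :|: B = (A :|: B) :\ y.
  by apply/setP=> x; rewrite !inE; case: eqP => // ->; rewrite (negbTE yB).
have cU : 1 < #|A :|: B|.
  by rewrite (leq_trans _ (subset_leq_card (subsetUl A B))) // cA.
rewrite (card_full_cycles_rec d yA cU sU).
rewrite (eq_bigr (fun z =>
   #|crossing (A :\ y) B (tperm y z * s * tperm y (s z))%g| * (a`! * b`!))); last first.
  move=> z /andP[zA _]; apply: IH => //; first by apply: disjointWl d; apply: subsetDl.
  by rewrite UE; apply: perm_on_contract => //; rewrite inE ?yA ?zA.
rewrite -big_distrl /= factS -!mulnA [RHS]mulnA; congr (_ * _).
pose y' := (s^-1)%g y; have sy' : s y' = y by rewrite permKV.
have y'U : (y' \in A) || (y' \in B).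
  by have := perm_closed y' sU; rewrite sy' !inE yA => /esym.
pose cr z := #|crossing (A :\ y) B (tperm y z * s * tperm y (s z))%g|.
have step z : z \in A -> s z != y -> cr z + ((y' \in B) && (s z \in B)) = #|crossing A B s|.
  exact: card_crossing_contract.
(* If [s^-1 y] is in [B], every [z] in [A] is allowed and each crossing is lost for exactly one [z].
   If it is in [A], the choice [z = s^-1 y] is excluded and no crossing is lost. The two sums
   agree. *)
have [y'B|y'B] := boolP (y' \in B).
  have nsz z : z \in A -> s z != y.
    move=> zA; rewrite -sy' (inj_eq perm_inj); apply: contraTneq zA => ->.
    by rewrite (disjointFl d).
  rewrite (eq_bigl (mem A)); last by move=> z /=; case zA: (z \in A); rewrite //= nsz.
  have : \sum_(z in A) (cr z + (s z \in B)) = \sum_(z in A) #|crossing A B s|.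
    by apply: eq_bigr => z zA; rewrite -(step z) ?nsz // y'B.
  rewrite big_split sum_nat_const cA /=.
  have -> : \sum_(z in A) (s z \in B) = #|crossing A B s|.
    rewrite -sum1_card [RHS]big_mkcond [LHS]big_mkcond; apply: eq_bigr => z _.
    by rewrite inE; do 2!case: (_ \in _).
  rewrite /cr; lia.
have y'A : y' \in A by rewrite (negbTE y'B) orbF in y'U.
rewrite (eq_bigr (fun _ => #|crossing A B s|)); last first.
  by move=> z /andP[zA sz]; rewrite -(step z) // (negbTE y'B) addn0.
rewrite sum_nat_const mulnC; congr (_ * _).
have -> : #|[pred z in A | s z != y]| = #|A :\ y'|.
  apply: eq_card => z; rewrite !inE andbC; congr (_ && _).
  by rewrite -{1}sy' (inj_eq perm_inj).
by move: cA; rewrite (cardsD1 y') y'A => -[].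
Qed.

(** * Contracting the points outside a set *)

(** Here [m] is a target number of cycles. Cutting out a point [x] outside [U] adds one cycle and
    one fixed point outside [U], so the bound on [m] persists. At the end [s] is supported on [U],
    where for nonempty [U] the bound is the least possible number of cycles. *)
Lemma contraction_ind (T : finType) (U : {set T}) (P : {perm T} -> nat -> Prop) :
  (forall (s : {perm T}) m, perm_on U s -> m <= #|~: U|.+1 -> P s m) ->
  (forall (s : {perm T}) m x, x \notin U -> s x != x -> P (s * tperm x (s x))%g m.+1 -> P s m) ->
  forall (s : {perm T}) m, m <= #|[set x in ~: U | s x == x]|.+1 -> P s m.
Proof.
move=> Pbase Pstep s m.
have [n] := ubnP #|[set x in ~: U | s x != x]|; elim: n s m => // n IH s m.
have [E _|[x]] := set_0Vmem [set x in ~: U | s x != x].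
  have sU : perm_on U s.
    apply/subsetP=> x; rewrite inE => nx; apply: contraT => xU.
    by have := in_set0 x; rewrite -E !inE xU nx.
  move=> lem; apply: Pbase => //; apply: leq_trans lem _.
  by rewrite ltnS; apply: subset_leq_card; apply/subsetP=> x; rewrite inE => /andP[].
rewrite !inE => /andP[xU nx] ltn lem; apply: (Pstep _ _ _ xU nx).
pose s' := (s * tperm x (s x))%g.
have s'x : s' x = x by rewrite permM tpermR.
have s'fix y : s y = y -> s' y = y.
  move=> sy; rewrite permM sy tpermD //; first by apply: contraNneq nx => ->; rewrite sy.
  by apply: contraNneq nx => sxy; rewrite -(inj_eq (@perm_inj _ s)) sxy sy.
apply: IH.
  rewrite -ltnS; apply: leq_ltn_trans ltn; apply: proper_card; apply/properP; split.
    apply/subsetP=> y; rewrite !inE => /andP[-> /=]; apply: contraNneq => sy.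
    by apply/eqP; apply: s'fix.
  by exists x; rewrite !inE ?xU ?nx // s'x eqxx.
apply: leq_ltn_trans lem _; rewrite ltnS; apply: proper_card; apply/properP; split.
  by apply/subsetP=> y; rewrite !inE => /andP[-> /= /eqP sy]; apply/eqP/s'fix.
by exists x; rewrite !inE xU /= -/s' ?s'x ?eqxx // (negbTE nx).
Qed.

(** Since [b] fixes [x], the product [b * s] sends [x] to [s x], so the transposition that cuts [x]
    out of [s] also cuts it out of [b * s]. *)
Lemma card_cycles_contract (T : finType) (H : {set {perm T}}) (s : {perm T}) m x :
  s x != x -> (forall b, b \in H -> b x = x) ->
  #|[set b in H | ncycles (b * (s * tperm x (s x)))%g == m.+1]|
  = #|[set b in H | ncycles (b * s)%g == m]|.
Proof.
move=> nx Hx; apply: eq_card => b; rewrite !inE; case bH: (b \in H) => //=.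
have E : (b * s)%g x = s x by rewrite permM (Hx _ bH).
by have := @ncycles_split _ (b * s)%g x; rewrite E mulgA => /(_ nx) ->.
Qed.

Lemma young2_out (T : finType) (A B : {set T}) (b : {perm T}) x :
  b \in young2 A B -> x \notin A :|: B -> b x = x.
Proof. by case/young2P=> bU _ xU; apply: out_perm xU. Qed.

Lemma young2_cyclesE (T : finType) (A B : {set T}) (s : {perm T}) :
  [set b in young2 A B | ncycles (b * s)%g == #|~: (A :|: B)|.+1] = full_cycles A B s.
Proof.
apply/setP=> b; rewrite inE [in RHS]inE; congr (_ && _).
by rewrite -(cardsC (A :|: B)) -addnS [in RHS](addnC #|A :|: B|) eqn_add2r.
Qed.

Lemma card_long_cycles_young1 (T : finType) (A : {set T}) (s : {perm T}) a :
  #|A| = a.+1 -> ncycles s = 1 ->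
  #|[set b in young2 A set0 | ncycles (b * s)%g == 1]| = a`!.
Proof.
move=> cA s1.
(* Carrying [ncycles t = m] through the contraction forces [m] to be [#|~: A|.+1] in the base case,
   which is then the one-block count. *)
pose P t m := ncycles t = m ->
  #|[set b in young2 A set0 | ncycles (b * t)%g == m]| = a`!.
suff : P s 1 by apply.
apply: (@contraction_ind _ A P) => // [{s1}s m sA lem E|t m x xA nx IH E].
  have [y yA] : exists y, y \in A by apply/set0Pn; rewrite -card_gt0 cA.
  have -> : m = #|~: (A :|: set0)|.+1.
    apply/eqP; rewrite setU0 eqn_leq lem /= -E.
    by have := ncycles_lower_bound yA sA; rewrite -(cardsC A) addnC ltn_add2r.
  by rewrite young2_cyclesE (card_full_cycles1 cA).
rewrite -(card_cycles_contract _ nx); last first.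
  by move=> b bY; apply: young2_out bY _; rewrite setU0.
by apply: IH; rewrite ncycles_split ?E.
Qed.

(** * Averaging over conjugates by permutations of two blocks *)

(** These permutations form a coset of the symmetric group on [U] without [u] and [v]. *)
Lemma card_perm_on_pair (T : finType) (U : {set T}) u v x y :
  u \in U -> v \in U -> u != v -> x \in U -> y \in U -> x != y ->
  #|[set h | [&& perm_on U h, h u == x & h v == y]]| = (#|U|.-2)`!.
Proof.
move=> uU vU uv xU yU xy.
(* A representative of the coset: [w] is where the first transposition puts [v], and the second
   moves it on to [y] without disturbing [x]. *)
pose w := tperm u x v; pose g := (tperm u x * tperm w y)%g.
have wU : w \in U by rewrite (perm_closed _ (perm_on_tperm uU xU)).
have gU : perm_on U g by rewrite perm_onM ?perm_on_tperm.
have gu : g u = x.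
  rewrite permM tpermL tpermD // 1?eq_sym //.
  by rewrite -(tpermL u x) (inj_eq perm_inj).
have gv : g v = y by rewrite permM tpermL.
have -> : #|U|.-2 = #|(U :\ u) :\ v|.
  by rewrite (cardsD1 u) uU (cardsD1 v) !inE vU eq_sym uv.
rewrite -card_perm -[RHS](card_imset _ (mulIg g)); apply: eq_card => h.
rewrite inE; apply/and3P/imsetP => [[hU /eqP hu /eqP hv]|[k kU ->]].
  exists (h * g^-1)%g; last by rewrite mulgKV.
  rewrite unfold_in; apply: perm_onD1; last by rewrite permM hv -gv permK.
  apply: perm_onD1; last by rewrite permM hu -gu permK.
  by rewrite perm_onM ?perm_onV.
have kU' : perm_on U k by apply: subset_trans kU _; rewrite setDDl subsetDl.
have ku : k u = u by rewrite (out_perm kU) // !inE eqxx andbF.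
have kv : k v = v by rewrite (out_perm kU) // !inE eqxx.
by rewrite perm_onM // ![(k * g)%g _]permM ku kv gu gv !eqxx.
Qed.

(** A crossing of [s ^ h] is the image under [h] of a moved point [u] with [h u] in [A] and
    [h (s u)] in [B]. Each of the [#|A| * #|B|] possible pairs of images comes from
    [(#|A :|: B| - 2)!] permutations [h]. *)
Lemma sum_crossing_conj (T : finType) (A B : {set T}) (s : {perm T}) :
  [disjoint A & B] -> perm_on (A :|: B) s ->
  \sum_(h : {perm T} | perm_on (A :|: B) h) #|crossing A B (s ^ h)%g|
  = #|[set u | s u != u]| * (#|A| * #|B| * (#|A :|: B|.-2)`!).
Proof.
move=> d sU; set U := A :|: B.
pose c (h : {perm T}) u : nat := (h u \in A) && (h (s u) \in B).
transitivity (\sum_(h : {perm T} | perm_on U h) \sum_u c h u).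
  apply: eq_bigr => h _; rewrite -sum1_card (reindex_inj (@perm_inj _ h)) big_mkcond.
  by apply: eq_bigr => u _; rewrite inE permJ /c; case: (_ && _).
rewrite exchange_big /= (bigID (fun u => s u != u)) /= [X in _ + X]big1 ?addn0.
  rewrite -sum_nat_cond_const; apply: eq_bigr => u nu.
  have suU : s u \in U by rewrite (perm_closed _ sU); apply: contraR nu => /(out_perm sU)->.
  have uU : u \in U by rewrite -(perm_closed _ sU).
  rewrite /c -big_mkcondr /=.
  rewrite (partition_big (fun h : {perm T} => (h u, h (s u))) (mem (setX A B))) /=; last first.
    by move=> h /andP[_]; rewrite inE.
  rewrite -cardsX -sum_nat_const; apply: eq_bigr => -[x y]; rewrite inE /= => /andP[xA yB].
  have xU : x \in U by rewrite inE xA.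
  have yU : y \in U by rewrite inE yB orbT.
  have xy : x != y by apply: contraTneq yB => <-; rewrite (disjointFr d).
  rewrite eq_sym in nu.
  rewrite -(card_perm_on_pair uU suU nu xU yU xy) -sum1_card; apply: eq_bigl => h.
  rewrite inE xpair_eqE; case: (h u =P x) => [->|]; case: (h (s u) =P y) => [->|]; rewrite ?andbF //.
  by rewrite xA yB !andbT.
move=> u; rewrite negbK => /eqP su; apply: big1 => h _; rewrite /c su.
by case huA: (h u \in A) => //=; rewrite (disjointFr d).
Qed.

(* The left-hand side depends on the two-block partition of [U] only through the
   order of its Young subgroup. *)
Lemma young2_average (T : finType) (U : {set T}) (s : {perm T}) m :
  m <= #|[set x in ~: U | s x == x]|.+1 ->
  exists K, forall A B : {set T},
    [disjoint A & B] -> A :|: B = U -> A != set0 -> B != set0 ->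
    \sum_(h : {perm T} | perm_on U h)
       #|[set b in young2 A B | ncycles (b * (s ^ h))%g == m]|
    = #|young2 A B| * K.
Proof.
move: s m; apply: contraction_ind => [s m sU lem|s m x xU nx [K KP]]; last first.
  exists K => A B d UE A0 B0; rewrite -KP //; apply: eq_bigr => h hU.
  (* As [h] fixes [x], conjugating by [h] after cutting [x] out of [s] amounts to cutting [x] out of
     [s ^ h]. *)
  have hx : h x = x by rewrite (out_perm hU).
  have E : (s ^ h)%g x = h (s x) by rewrite -{1}hx permJ.
  rewrite conjMg tpermJ hx -E card_cycles_contract //.
    by rewrite E -[X in _ != X]hx (inj_eq perm_inj).
  by move=> b bY; apply: young2_out bY _; rewrite UE.
move: lem; rewrite leq_eqVlt => /orP[/eqP ->|lem].
  (* The factor [#|A| * #|B|] from the crossings completes [(#|A| - 1)! (#|B| - 1)!] to the order of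
     the Young subgroup; this [K] is what remains. *)
  exists (#|[set u | s u != u]| * (#|U|.-2)`!) => A B d UE A0 B0.
  have [[a cA] [b cB]] : (exists a, #|A| = a.+1) /\ (exists b, #|B| = b.+1).
    by split; [exists #|A|.-1 | exists #|B|.-1]; rewrite prednK // card_gt0.
  rewrite (eq_bigr (fun h => #|crossing A B (s ^ h)%g| * (a`! * b`!))); last first.
    move=> h hU; rewrite -UE young2_cyclesE; apply: card_full_cycles2 => //.
    by rewrite UE !perm_onM ?perm_onV.
  rewrite -big_distrl /= -UE sum_crossing_conj ?UE // card_young2 //.
  rewrite cA cB !factS; lia.
(* Here [m] is below the least number of cycles of a permutation supported on [U], so every count
   vanishes. *)
exists 0 => A B d UE A0 B0; rewrite muln0; apply: big1 => h hU; apply/eqP.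
rewrite cards_eq0; apply/eqP/setP=> b; rewrite inE in_set0.
apply/andP=> -[/young2P[]]; rewrite UE => bU _ /eqP E.
have [w wU] : exists w, w \in U.
  by case/set0Pn: A0 => w wA; exists w; rewrite -UE inE wA.
have dU : perm_on U (b * (s ^ h))%g by rewrite !perm_onM ?perm_onV.
have := ncycles_lower_bound wU dU.
by rewrite E -(cardsC U) addnC ltn_add2r ltnNge -ltnS lem.
Qed.

(** * Conjugation, and Young subgroups of colourings *)

Lemma card_permT (T : finType) : #|{perm T}| = #|T|`!.
Proof.
rewrite -cardsT -card_perm; apply: eq_card => s; rewrite unfold_in.
by apply/esym/subsetP => x; rewrite inE.
Qed.

Lemma porbitsJ (T : finType) (s g : {perm T}) :
  porbits (s ^ g)%g = [set g @: (X : {set T}) | X in porbits s].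
Proof.
have E x : porbit (s ^ g)%g (g x) = g @: porbit s x.
  apply/setP=> y; apply/porbitP/imsetP => [[i ->]|[z /porbitP[i ->] ->]].
    by exists ((s ^+ i)%g x); rewrite ?mem_porbit // -conjXg permJ.
  by exists i; rewrite -conjXg permJ.
rewrite /porbits -imset_comp; apply/setP=> X.
apply/imsetP/imsetP => [[x _ ->]|[x _ ->]].
  by exists ((g^-1)%g x); rewrite // /= -E permKV.
by exists (g x); rewrite //= E.
Qed.

Lemma ncyclesJ (T : finType) (s g : {perm T}) : ncycles (s ^ g)%g = ncycles s.
Proof. by rewrite porbitsJ; apply: card_imset (imset_inj (@perm_inj _ g)). Qed.

(** Blocks are encoded as fibres of a colouring, so that moving a point to another block is a change
    of one value. *)
Definition young (T : finType) (V : eqType) (f : T -> V) : {set {perm T}} :=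
  [set b : {perm T} | [forall x, f (b x) == f x]].

Lemma youngP (T : finType) (V : eqType) (f : T -> V) (b : {perm T}) :
  reflect (forall x, f (b x) = f x) (b \in young f).
Proof.
by rewrite inE; apply: (iffP forallP) => H x; [apply/eqP | rewrite H].
Qed.

Lemma young1 (T : finType) (V : eqType) (f : T -> V) : 1%g \in young f.
Proof. by apply/youngP=> x; rewrite perm1. Qed.

Lemma restr_perm_out (T : finType) (S : {set T}) (b : {perm T}) x :
  x \notin S -> restr_perm S b x = x.
Proof. exact: out_perm (restr_perm_on S b). Qed.

Lemma restr_perm_young (T : finType) (V : eqType) (f : T -> V) (S : {set T}) b :
  b \in young f -> restr_perm S b \in young f.
Proof.
move/youngP=> bf; apply/youngP=> x.
have [xS|xS] := boolP (x \in S); last by rewrite restr_perm_out.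
have [bS|bS] := boolP (b \in 'N(S | 'P)%g); first by rewrite restr_permE.
(* By default [restr_perm] is the identity when [S] is not stable. *)
by rewrite triv_restr_perm // perm1.
Qed.

Definition fibre (T : finType) (V : eqType) (f : T -> V) (u : V) : {set T} :=
  [set x | f x == u].

Lemma disjoint_fibre (T : finType) (V : eqType) (f : T -> V) (u v : V) :
  u != v -> [disjoint fibre f u & fibre f v].
Proof.
move=> uv; rewrite -setI_eq0; apply/eqP/setP=> x; rewrite !inE.
by case: eqP => // ->; rewrite (negbTE uv).
Qed.

Definition young_on (T : finType) (V : eqType) (f : T -> V) (U : {set T}) :=
  [set b in young f | perm_on U b].

Lemma young_on2 (T : finType) (V : eqType) (f : T -> V) (u v : V) :
  u != v ->
  young_on f (fibre f u :|: fibre f v) = young2 (fibre f u) (fibre f v).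
Proof.
move=> uv; apply/setP=> b; rewrite inE; apply/andP/young2P.
  by move=> [/youngP bf bU]; split=> // x; rewrite !inE bf.
move=> [bU bA]; split=> //; apply/youngP=> x.
have := perm_closed x bU; have := bA x; rewrite !inE => ->.
have [fxu _|fxu /= E] := eqVneq (f x) u.
  by apply/eqP; have := bA x; rewrite !inE fxu eqxx.
have [Ev|fxv] := eqVneq (f x) v; first by rewrite Ev eqxx in E; rewrite Ev (eqP E).
by rewrite (out_perm bU) // !inE negb_or fxu fxv.
Qed.

(** The hypothesis makes [U] a union of fibres; restriction to [U] and to its complement then splits
    the Young subgroup as a direct product. *)
Lemma sum_young (T : finType) (V : eqType) (f : T -> V) (U : {set T})
    (F : {perm T} -> nat) :
  (forall x y, f x = f y -> x \in U -> y \in U) ->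
  \sum_(b in young f) F b
  = \sum_(b1 in young_on f (~: U)) \sum_(b2 in young_on f U) F (b2 * b1)%g.
Proof.
move=> fU; rewrite pair_big /=.
have stab b : b \in young f -> (b \in 'N(U | 'P)%g) * (b \in 'N(~: U | 'P)%g).
  move=> /youngP bf; have E x : (b x \in U) = (x \in U).
    by apply/idP/idP; apply: fU; rewrite bf.
  by split; apply/astabsP => x; rewrite /= apermE ?in_setC E.
rewrite (reindex_onto (fun p => p.2 * p.1)%g
   (fun b => (restr_perm (~: U) b, restr_perm U b))) /=; last first.
  move=> b bf; apply/permP=> x; rewrite permM.
  have [xU|xU] := boolP (x \in U).
    have bxU : b x \in U by have /youngP bf' := bf; apply: fU xU; rewrite bf'.
    rewrite (restr_permE (stab _ bf).1 xU) restr_perm_out //.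
    by rewrite in_setC negbK.
  by rewrite (restr_perm_out _ xU) restr_permE ?(stab _ bf).2 // in_setC.
apply: eq_bigl => -[b1 b2] /=; rewrite xpair_eqE.
apply/and3P/andP => [[bf /eqP E1 /eqP E2]|[]].
  have b1f : b1 \in young f by rewrite -E1 restr_perm_young.
  have b2f : b2 \in young f by rewrite -E2 restr_perm_young.
  have b1U : perm_on (~: U) b1 by rewrite -E1 restr_perm_on.
  have b2U : perm_on U b2 by rewrite -E2 restr_perm_on.
  by split; apply/setIdP.
move=> /setIdP[b1f b1U] /setIdP[b2f b2U].
have bf : (b2 * b1)%g \in young f.
  by apply/youngP=> x; rewrite permM (youngP _ _ b1f) (youngP _ _ b2f).
split=> //; apply/eqP/permP=> x.
  have [xU|xU] := boolP (x \in ~: U); last by rewrite restr_perm_out // (out_perm b1U).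
  by rewrite restr_permE ?stab // permM (out_perm b2U) // -in_setC.
have [xU|xU] := boolP (x \in U); last by rewrite restr_perm_out // (out_perm b2U).
rewrite restr_permE ?stab // permM (out_perm b1U) //.
by rewrite inE negbK (perm_closed _ b2U).
Qed.

(** * Counting over all conjugates of the long cycle *)

(** Divided by [#|T|! * #|young f|], this is the probability that a random element of the Young
    subgroup times a random conjugate of [c] is a single cycle. *)
Definition long_count (T : finType) (V : eqType) (c : {perm T}) (f : T -> V) : nat :=
  \sum_(g : {perm T}) #|[set b in young f | ncycles (b * c ^ g)%g == 1]|.

Lemma card_set_cond (T : finType) (H : {set T}) (Q : pred T) :
  #|[set b in H | Q b]| = \sum_(b in H) Q b.
Proof.
rewrite -sum1_card big_mkcond [RHS]big_mkcond; apply: eq_bigr => b _.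
by rewrite inE; case: (b \in H); case: (Q b).
Qed.

(** Replacing [g] by [g * h] conjugates [c ^ g] by [h]. The factor [b1] lives off [U] and commutes
    with [h], so [b1 * c ^ g] is conjugated as a whole, as [young2_average] requires. *)
Lemma long_count_average (T : finType) (V : eqType) (c : {perm T}) (f : T -> V) u v :
  u != v -> let U := fibre f u :|: fibre f v in
  long_count c f * #|[set h | perm_on U h]| =
  \sum_(g : {perm T}) \sum_(b1 in young_on f (~: U)) \sum_(h : {perm T} | perm_on U h)
    #|[set b in young2 (fibre f u) (fibre f v) | ncycles (b * (b1 * c ^ g) ^ h)%g == 1]|.
Proof.
move=> uv U; rewrite mulnC -sum_nat_cond_const.
under [RHS]eq_bigr => g _ do rewrite exchange_big.
rewrite [RHS]exchange_big /=; apply: eq_bigr => h hU.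
rewrite /long_count (reindex_inj (mulIg h)); apply: eq_bigr => g _.
rewrite card_set_cond (sum_young (U := U)); last first.
  by move=> x y E; rewrite !inE E.
apply: eq_bigr => b1 /setIdP[_ b1U].
rewrite card_set_cond young_on2 //; apply: eq_bigr => b2 _.
have b1h : (b1 ^ h)%g = b1.
  apply/conjg_fixP/commgP; apply: (perm_onC b1U hU).
  by rewrite -setI_eq0 setIC setICr.
by rewrite conjMg b1h -conjgM -mulgA.
Qed.

(** An equality of probabilities, cross-multiplied. Both colourings give the same group off [U], and
    on [U] the average is the order of the two-block Young subgroup times a common constant. *)
Lemma long_count_recolor (T : finType) (V : eqType) (c : {perm T}) (f f' : T -> V) u v :
  u != v -> fibre f u :|: fibre f v = fibre f' u :|: fibre f' v ->
  (forall x, x \notin fibre f u :|: fibre f v -> f x = f' x) ->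
  fibre f u != set0 -> fibre f v != set0 ->
  fibre f' u != set0 -> fibre f' v != set0 ->
  long_count c f * #|young f'| = long_count c f' * #|young f|.
Proof.
move=> uv EU Eout fu fv f'u f'v; set U := fibre f u :|: fibre f v in EU Eout.
have EO : young_on f (~: U) = young_on f' (~: U).
  apply/setP=> b; rewrite !in_set; case bU: (perm_on (~: U) b); rewrite ?andbF // !andbT.
  apply: eq_forallb => x.
  have [xU|xU] := boolP (x \in U).
    by rewrite (out_perm bU) ?in_setC ?negbK ?eqxx.
  rewrite !Eout //.
  by have := perm_closed x bU; rewrite !in_setC xU.
have cY (h : T -> V) : fibre h u :|: fibre h v = U ->
    #|young h| = #|young_on h (~: U)| * #|young2 (fibre h u) (fibre h v)|.
  move=> hU; rewrite -sum1_card (sum_young (U := U)); last first.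
    by move=> x y E; rewrite -hU !inE E.
  by rewrite -sum_nat_const; apply: eq_bigr => b _; rewrite sum1_card -hU young_on2.
have d := disjoint_fibre f uv; have d' := disjoint_fibre f' uv.
pose p := #|[set h : {perm T} | perm_on U h]|.
have p0 : 0 < p by rewrite card_gt0; apply/set0Pn; exists 1%g; rewrite inE perm_on1.
apply/eqP; rewrite -(eqn_pmul2r p0).
have avg (h : T -> V) : fibre h u :|: fibre h v = U -> long_count c h * p =
    \sum_(g : {perm T}) \sum_(b1 in young_on h (~: U)) \sum_(k : {perm T} | perm_on U k)
      #|[set b in young2 (fibre h u) (fibre h v) | ncycles (b * (b1 * c ^ g) ^ k)%g == 1]|.
  by move=> hU; rewrite /p -hU long_count_average.
rewrite mulnAC [X in _ == X]mulnAC.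
rewrite (avg f) // (avg f') // -EO.
rewrite (cY f') // (cY f) // -EO.
rewrite !(mulnCA _ #|young_on f (~: U)|); apply/eqP; congr (_ * _).
rewrite !big_distrl /=; apply: eq_bigr => g _.
rewrite !big_distrl /=; apply: eq_bigr => b1 _.
(* One [K] serves both splittings of [U]; the target is a single cycle on all of [T]. *)
have [K KP] := @young2_average T U (b1 * c ^ g)%g 1 (ltn0Sn _).
by rewrite KP // KP // -mulnA mulnC (mulnC K).
Qed.

(** Only the colour of [x0] is shared, so the Young subgroup is the symmetric group on that fibre
    and all conjugates of [c] contribute the same factorial. *)
Lemma long_count_rigid (T : finType) (V : finType) (c : {perm T}) (f : T -> V) x0 :
  ncycles c = 1 ->
  (forall x y, f x = f y -> f x != f x0 -> x = y) ->
  long_count c f * (#|T| - #|[set f x | x : T]| + 1) = #|T|`! * #|young f|.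
Proof.
move=> c1 inj; set u := f x0 in inj; pose A := fibre f u.
have x0A : x0 \in A by rewrite inE.
have Yf : young f = young2 A set0.
  rewrite young2_0r; apply/setP=> b; rewrite [RHS]inE; apply/youngP/idP.
    move=> bf; apply/subsetP=> x; rewrite !inE; apply: contraR => fx.
    by apply/eqP; apply: inj; rewrite bf.
  move=> bA x; have := perm_closed x bA; rewrite !inE.
  have [->|fx] := eqVneq (f x) u; first by move/eqP.
  by move=> _; rewrite (out_perm bA) // inE.
have [a cA] : exists a, #|A| = a.+1.
  by exists #|A|.-1; rewrite prednK // card_gt0; apply/set0Pn; exists x0.
have im : [set f x | x : T] = u |: f @: (~: A).
  apply/setP=> w; apply/imsetP/setU1P => [[x _ ->]|[->|/imsetP[x _ ->]]].
  - have [->|fx] := eqVneq (f x) u; [by left | right].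
    by apply: imset_f; rewrite !inE.
  - by exists x0.
  - by exists x.
have cim : #|[set f x | x : T]| = #|~: A|.+1.
  rewrite im cardsU1 card_in_imset; last first.
    by move=> x y; rewrite !inE => fx _ E; apply: inj.
  case: imsetP => // -[x]; rewrite !inE => fx ux; by rewrite ux eqxx in fx.
have -> : #|T| - #|[set f x | x : T]| + 1 = a.+1.
  by rewrite cim -(cardsC A) cA; lia.
have -> : long_count c f = #|T|`! * a`!.
  rewrite /long_count (eq_bigr (fun _ => a`!)).
    by rewrite sum_nat_const -card_permT.
  by move=> g _; rewrite Yf (card_long_cycles_young1 cA) // ncyclesJ.
by rewrite Yf card_young2 -?setI_eq0 ?setI0 // cA cards0 fact0 muln1 -mulnA (mulnC a`!) -factS.
Qed.

(** Induction on the number of points not coloured like [x0]: recolouring leads to the rigid case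
    without changing the probability or the set of colours. *)
Lemma long_countE (T V : finType) (c : {perm T}) (f : T -> V) (x0 : T) :
  ncycles c = 1 ->
  long_count c f * (#|T| - #|[set f x | x : T]| + 1) = #|T|`! * #|young f|.
Proof.
move=> c1; have [n] := ubnP #|[set x | f x != f x0]|; elim: n f => // n IH f lefn.
have [|nrigid] := boolP [forall x, forall y, (f x == f y) && (f x != f x0) ==> (x == y)].
  move=> /forallP rigid; apply: (long_count_rigid (x0 := x0) c1) => x y E fx.
  by have /forallP/(_ y)/implyP := rigid x; rewrite E -E eqxx fx => /(_ isT)/eqP.
move: nrigid; rewrite negb_forall => /existsP[x]; rewrite negb_forall => /existsP[y].
rewrite negb_imply => /andP[/andP[/eqP Exy fx] xy].
set u := f x0 in fx lefn *; pose v := f x.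
(* All points of colour [v] except [y] take the colour of [x0]. Keeping [y] preserves the set of
   colours, and recolouring [x] makes the measure drop. *)
pose f' z := if (f z == v) && (z != y) then u else f z.
have f'x0 : f' x0 = u by rewrite /f'; case: ifP.
have f'y : f' y = v by rewrite /f' eqxx andbF /v Exy.
have f'x : f' x = u by rewrite /f' eqxx xy.
have f'u z : (f' z == u) = (f z == u) || (f z == v) && (z != y).
  by rewrite /f'; case: ifP => _; rewrite ?eqxx ?orbT ?orbF.
have im : [set f' z | z : T] = [set f z | z : T].
  apply/setP=> w; apply/imsetP/imsetP => -[z _ ->].
    by rewrite /f'; case: ifP => _; [exists x0 | exists z].
  have [fz|fz] := eqVneq (f z) v; first by exists y; rewrite ?f'y.
  by exists z; rewrite // /f' (negbTE fz).
have IHf' : long_count c f' * (#|T| - #|[set f z | z : T]| + 1) = #|T|`! * #|young f'|.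
  rewrite -im; apply: IH; rewrite -ltnS; apply: leq_ltn_trans lefn.
  apply: proper_card; apply/properP; rewrite f'x0; split.
    by apply/subsetP=> z; rewrite !inE f'u negb_or => /andP[].
  by exists x; rewrite !inE ?f'x ?eqxx.
have vu : u != v by rewrite eq_sym.
have Yf'0 : 0 < #|young f'| by apply/card_gt0P; exists 1%g; apply: young1.
have ne0 (h : T -> V) w z : h z = w -> fibre h w != set0.
  by move=> hz; apply/set0Pn; exists z; rewrite inE hz.
have f'v z : (f' z == v) = (z == y).
  rewrite /f'; have [fz|fz] := eqVneq (f z) v => /=.
    by case: (z =P y) => [->|_] /=; rewrite -?Exy ?eqxx // (negbTE vu).
  by rewrite (negbTE fz); apply/esym/eqP => zy; rewrite zy -Exy eqxx in fz.
have E : long_count c f * #|young f'| = long_count c f' * #|young f|.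
  apply: (@long_count_recolor T V c f f' u v) => //.
  - apply/setP=> z; rewrite !inE f'u f'v; case: (z =P y) => [->|]; rewrite ?andbT ?orbF //.
    by rewrite -Exy eqxx !orbT.
  - by move=> z; rewrite !inE negb_or /f' => /andP[_ /negbTE->].
  - exact: (ne0 _ _ x0).
  - exact: (ne0 _ _ x).
  - exact: (ne0 _ _ x0).
  - exact: (ne0 _ _ y).
by apply/eqP; rewrite -(eqn_pmul2r Yf'0) mulnAC E mulnAC IHf' mulnAC.
Qed.

(** * Relabelling set partitions, and their link with colourings *)

Definition image_blocks N (g : {perm 'I_N}) (P : {set {set 'I_N}}) : {set {set 'I_N}} := [set g @: (B : {set 'I_N}) | B in P].

Lemma image_blocksM N (g h : {perm 'I_N}) (P : {set {set 'I_N}}) :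
  image_blocks (g * h)%g P = image_blocks h (image_blocks g P).
Proof.
rewrite /image_blocks -imset_comp; apply: eq_imset => B /=.
by rewrite -imset_comp; apply: eq_imset => x; rewrite permM.
Qed.

Lemma image_blocks1 N (P : {set {set 'I_N}}) : image_blocks 1%g P = P.
Proof.
rewrite /image_blocks -[RHS]imset_id; apply: eq_imset => B /=.
by rewrite -[RHS]imset_id; apply: eq_imset => x; rewrite perm1.
Qed.

Lemma image_blocksK N (g : {perm 'I_N}) : cancel (image_blocks g) (image_blocks g^-1%g).
Proof. by move=> P; rewrite -image_blocksM mulgV image_blocks1. Qed.

Lemma image_blocks_type N (g : {perm 'I_N}) (P : {set {set 'I_N}}) (lam : seq nat) :
  (image_blocks g P \in setparts_of_type N lam) = (P \in setparts_of_type N lam).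
Proof.
have gI : injective (fun B : {set 'I_N} => g @: B) := imset_inj (@perm_inj _ g).
rewrite !inE; congr (_ && _).
  rewrite -(imset_partition P [set: 'I_N] (@perm_inj _ g)); congr (partition _ _).
  by apply/esym/setP=> x; rewrite inE -[x](permKV g) imset_f ?inE.
congr (_ == _); apply/perm_sortP.
- by move=> m n; apply: leq_total.
- by move=> m n p /= mn np; apply: leq_trans np mn.
- by move=> m n /=; rewrite andbC -eqn_leq => /eqP.
have -> : [seq #|B| | B : {set 'I_N} <- enum P]
        = [seq #|B| | B : {set 'I_N} <- [seq g @: B | B : {set 'I_N} <- enum P]].
  by rewrite -map_comp; apply: eq_map => B /=; rewrite card_imset //; apply: perm_inj.
apply: perm_map; apply: uniq_perm; rewrite ?enum_uniq ?map_inj_uniq ?enum_uniq //.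
move=> B; rewrite mem_enum; apply/imsetP/mapP => -[C].
  by exists C; rewrite ?mem_enum.
by rewrite mem_enum; exists C.
Qed.

Lemma S_piJ N (g : {perm 'I_N}) (P : {set {set 'I_N}}) (b : {perm 'I_N}) :
  (b ^ g \in S_pi (image_blocks g P))%g = (b \in S_pi P).
Proof.
suff sub (h : {perm 'I_N}) Q (d : {perm 'I_N}) : d \in S_pi Q -> (d ^ h \in S_pi (image_blocks h Q))%g.
  apply/idP/idP; last exact: sub.
  by move/(sub g^-1%g); rewrite conjgK image_blocksK.
rewrite !inE => /forall_inP dQ; apply/forall_inP=> C; rewrite porbitsJ.
case/imsetP=> D /dQ/exists_inP[B BQ DB] ->; apply/exists_inP.
by exists (h @: B); [apply: imset_f | apply: imsetS].
Qed.

(** The colour of a point is its block: a cycle stays inside one block as soon as each of its single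
    steps does. *)
Lemma S_piE N (P : {set {set 'I_N}}) :
  partition P [set: 'I_N] -> S_pi P = young (pblock P).
Proof.
move=> PN; have tI := partition_trivIset PN.
have cov x : x \in cover P by rewrite (cover_partition PN) inE.
apply/setP=> b; rewrite [LHS]inE; apply/forall_inP/youngP => [H x|H C].
  have /H/exists_inP[B BP /subsetP CB] : porbit b x \in porbits b by apply: imset_f.
  have xB : x \in B := CB _ (porbit_id b x).
  have bxB : b x \in B by apply: CB; rewrite -[b]expg1 mem_porbit.
  by rewrite !(def_pblock tI BP).
case/imsetP=> x _ ->; apply/exists_inP; exists (pblock P x); first exact: pblock_mem.
apply/subsetP=> _ /porbitP[i ->].
have <- : pblock P ((b ^+ i)%g x) = pblock P x.
  by elim: i => [|i IH]; rewrite ?expg0 ?perm1 // expgSr permM H.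
by rewrite mem_pblock.
Qed.

Lemma image_pblock (T : finType) (P : {set {set T}}) :
  partition P [set: T] -> [set pblock P x | x : T] = P.
Proof.
move=> PT; have tI := partition_trivIset PT; apply/setP=> B.
apply/imsetP/idP => [[x _ ->]|BP].
  by apply: pblock_mem; rewrite (cover_partition PT) inE.
have /set0Pn[x xB] := partition_neq0 PT BP.
by exists x; rewrite // (def_pblock tI BP xB).
Qed.

Lemma is_NcycleE N (s : {perm 'I_N}) : 0 < N -> is_Ncycle s = (ncycles s == 1).
Proof.
move=> N0; apply/existsP/cards1P => [[x /eqP sx]|[X sX]].
  exists [set: 'I_N]; apply/setP=> X; rewrite inE; apply/imsetP/eqP => [[y _ ->]|->].
    by rewrite -sx; apply/eqP; rewrite eq_porbit_mem sx inE.
  by exists x.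
pose x := Ordinal N0.
have SX y : porbit s y = X by apply/set1P; rewrite -sX imset_f.
exists x; apply/eqP/setP=> y; rewrite inE SX -(SX y); exact: porbit_id.
Qed.

Lemma ncycles_long_cycle N : 0 < N -> ncycles (long_cycle N) = 1.
Proof.
case: N => // n _; apply/eqP; rewrite -is_NcycleE //; apply/existsP; exists ord0.
have pow i : i <= n -> (long_cycle n.+1 ^+ i)%g ord0 = i :> nat.
  elim: i => [|i IH] lin; first by rewrite expg0 perm1.
  by rewrite expgSr permM permE /= IH ?modn_small // ltnW.
apply/eqP/setP=> y; rewrite [RHS]inE; apply/porbitP; exists y; apply/val_inj.
by rewrite /= pow // -ltnS.
Qed.

(** Blocks are drawn one after another from what is left of [D]. This supplies a set partition of
    the prescribed type. *)
Lemma partition_of_sizes (T : finType) (lam : seq nat) (D : {set T}) :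
  all (fun k => 0 < k) lam -> sumn lam = #|D| ->
  exists P : {set {set T}},
    partition P D /\ perm_eq [seq #|B| | B : {set T} <- enum P] lam.
Proof.
elim: lam D => [|k lam IH] D /=.
  move=> _ /esym/eqP; rewrite cards_eq0 => /eqP ->; exists set0.
  by rewrite partition_set0 enum_set0 /=.
move=> /andP[k0 lam0] sD.
have [B /andP[BD /eqP cB]] : exists B : {set T}, (B \subset D) && (#|B| == k).
  have : 0 < #|[set A : {set T} | A \subset D & #|A| == k]|.
    by rewrite cards_draws bin_gt0 -sD leq_addr.
  by case/card_gt0P=> B; rewrite inE; exists B.
have cDB : sumn lam = #|D :\: B|.
  by rewrite cardsD (setIidPr BD) cB -sD addKn.
have [P [PD Plam]] := IH _ lam0 cDB.
have B0 : B != set0 by rewrite -card_gt0 cB.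
have dB : [disjoint B & D :\: B].
  by rewrite -setI_eq0 setIDA setDIl setDv set0I.
have BP : B \notin P.
  apply: contraNN B0 => /(partitionS PD) sB; rewrite -subset0 -(setDv B).
  by apply/subsetP=> x xB; have := subsetP sB _ xB; rewrite !inE xB.
exists (B |: P); split.
  by rewrite -(setID D B) (setIidPr BD) partitionU1.
apply: (@perm_trans _ [seq #|C| | C : {set T} <- B :: enum P]).
  apply: perm_map; apply: uniq_perm; rewrite /= ?enum_uniq ?mem_enum ?BP //.
  by move=> C; rewrite mem_enum !inE mem_enum.
by rewrite /= cB perm_cons.
Qed.

(** * The probability *)

Local Open Scope ring_scope.

(** Conjugation by [g^-1] brings the subgroup of the relabelled partition back to that of [P] and
    turns [c] into [c ^ g^-1], so the sum over [g] becomes a [long_count]. *)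
Lemma sum_prob_conj N (P : {set {set 'I_N}}) (p : nat) :
  (0 < N)%N -> partition P [set: 'I_N] -> #|P| = p ->
  \sum_(g : {perm 'I_N})
     (#|[set b in S_pi (image_blocks g P) | is_Ncycle ((b^-1)%g * long_cycle N)%g]|%:R
        / #|S_pi (image_blocks g P)|%:R)
  = (N`!)%:R / (N - p + 1)%N%:R :> rat.
Proof.
move=> N0 PN cP; set c := long_cycle N.
have cJ g : #|S_pi (image_blocks g P)| = #|S_pi P|.
  rewrite -[RHS](card_imset _ (conjg_inj g)); apply: eq_card => b.
  apply/idP/imsetP => [bg|[d dP ->]]; last by rewrite S_piJ.
  by exists (b ^ g^-1)%g; rewrite ?conjgKV // -(S_piJ g) conjgKV.
have good g : #|[set b in S_pi (image_blocks g P) | is_Ncycle ((b^-1)%g * c)%g]|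
            = #|[set b in young (pblock P) | ncycles (b * c ^ (g^-1))%g == 1%N]|.
  (* The second reindexing removes the inverse on [b], the Young subgroup being closed under
     inverses. *)
  rewrite !card_set_cond (reindex_inj (conjg_inj g)) (reindex_inj invg_inj) /=.
  apply: eq_big => [b|b _].
    rewrite S_piJ (S_piE PN); apply/youngP/youngP => H x.
      by rewrite -[in RHS](permK b x) H.
    by rewrite -[in RHS](permKV b x) H.
  by rewrite is_NcycleE // -conjVg invgK -(ncyclesJ _ (g^-1)) conjMg conjgK.
under eq_bigr => g _ do rewrite cJ good.
rewrite -big_distrl /= -natr_sum (reindex_inj invg_inj) /=.
have E := long_countE (pblock P) (Ordinal N0) (ncycles_long_cycle N0).
rewrite (image_pblock PN) cP card_ord in E.
have -> : (\sum_j #|[set b in young (pblock P) | ncycles (b * c ^ (j^-1^-1))%g == 1%N]|)%N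
          = long_count c (pblock P).
  by apply: eq_bigr => g _; rewrite invgK.
have Y0 : (0 < #|young (pblock P)|)%N by apply/card_gt0P; exists 1%g; apply: young1.
rewrite (S_piE PN); apply/eqP; rewrite eqr_div ?pnatr_eq0 ?addn1 // -?lt0n //.
by rewrite -!natrM -[(N - p).+1]addn1 E.
Qed.

Theorem theorem1p3 (N : nat) (lam : seq nat) :
  (0 < N)%N -> is_int_partition N lam ->
  prob_Ncycle N lam = ((N - size lam + 1)%N%:R)^-1.
Proof.
move=> N0 /and3P[lam0 lams /eqP lamN].
pose X P : rat := #|[set b in S_pi P | is_Ncycle ((b^-1)%g * long_cycle N)%g]|%:R
        / #|S_pi P|%:R.
set Pi := setparts_of_type N lam; set q := (N - size lam + 1)%N%:R.
have geq_tr : transitive geq by move=> m n p /= mn np; apply: leq_trans np mn.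
(* A set partition of type [lam] exists, so [#|Pi|] can be cancelled at the end. *)
have [P0 [P0N P0lam]] : exists P : {set {set 'I_N}}, partition P [set: 'I_N] /\
    perm_eq [seq #|B| | B : {set 'I_N} <- enum P] lam.
  by apply: partition_of_sizes; rewrite // cardsT card_ord.
have P0Pi : P0 \in Pi.
  rewrite inE P0N /= /setpart_type -(sorted_sort geq_tr lams); apply/eqP/perm_sortP => //.
  - by move=> m n; apply: leq_total.
  - by move=> m n /=; rewrite andbC -eqn_leq => /eqP.
have Pi0 : #|Pi|%:R != 0 :> rat.
  by rewrite pnatr_eq0 -lt0n; apply/card_gt0P; exists P0.
have avg P : P \in Pi -> \sum_(g : {perm 'I_N}) X (image_blocks g P) = (N`!)%:R / q.
  rewrite inE => /andP[PN /eqP Plam]; apply: sum_prob_conj => //.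
  by rewrite -Plam size_sort size_map -cardE.
(* The sum over pairs of [g] and [P] is computed twice: each [g] permutes [Pi], and for each fixed
   [P] the sum over [g] is [N! / q]. *)
have tot : (N`!)%:R * \sum_(P in Pi) X P = #|Pi|%:R * ((N`!)%:R / q).
  transitivity (\sum_(g : {perm 'I_N}) \sum_(P in Pi) X (image_blocks g P)).
    rewrite [RHS](eq_bigr (fun _ => \sum_(P in Pi) X P)).
      have cS : #|{perm 'I_N}| = N`! by rewrite card_permT card_ord.
      by rewrite sumr_const mulr_natl -cS.
    move=> g _; rewrite [RHS](reindex_inj (can_inj (image_blocksK g))) /=.
    by apply: eq_bigl => P; rewrite image_blocks_type.
  by rewrite exchange_big /= (eq_bigr _ avg) sumr_const [RHS]mulr_natl.
have NF : (N`!)%:R != 0 :> rat by rewrite pnatr_eq0 -lt0n fact_gt0.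
rewrite /prob_Ncycle -big_distrr /= -/Pi.
apply: (mulfI Pi0); rewrite mulrA mulfV // mul1r.
by apply: (mulfI NF); rewrite tot mulrCA.
Qed.
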